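(* Let $\mathcal T$ denote the discrete topology on $S=\{0,h,1\}$ and let $\mathbf S_{os}=\langle S;\{r_2\},\{\lambda_1\},\mathcal T\rangle$, with the single relation $r_2$ and the single partial operation $\lambda_1$. Then $\mathbf S_{os}$ yields an optimal strong duality on $\mathcal A=ISP(\mathbb S)$: it yields a strong duality on $\mathcal A$, and deleting either $r_2$ or $\lambda_1$ from the structure gives a structure that does not yield a strong duality on $\mathcal A$.
   Context: $\mathbb{S}$ is the three-element Boolean semiring with carrier $S=\{0,h,1\}$: multiplication is the minimum for the chain $0<h<1$, and addition is commutative with $0+x=x$, $1+1=h$, $h+h=h$, $1+h=1$. Equivalently (up to term equivalence) it is the chain $0<h<1$ with constants $0,h,1$, $\wedge=\min$, $\vee=\max$ and unary operation $\overline{x}=1+x$ ($\overline0=\overline h=1$, $\overline1=h$). $\mathcal A=ISP(\mathbb S)$ is the quasi-variety generated by $\mathbb S$; $\mathcal A(A,B)$ is the set of homomorphisms. $r_2=S^2\setminus\{(h,0),(1,0)\}$. $\lambda_1$ is the binary partial operation on $S$ with domain $r_1=S^2\setminus\{(1,0)\}$ and graph (triples $(x,y,\lambda_1(x,y))$) $\{(0,0,0),(h,h,h),(1,1,1),(0,h,h),(0,1,h),(h,0,0),(h,1,h),(1,h,1)\}$. Let $\mathbf S'=\langle S;R,G,H,\mathcal T\rangle$ have relations $R$, total operations $G$ and partial operations $H$, all algebraic (relations are subalgebras of powers of $\mathbb S$; operations and partial operations are homomorphisms from powers, resp. subalgebras of powers, of $\mathbb S$ to $\mathbb S$), with $\mathcal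 T$ discrete. $\mathcal X'=IS_cP^+(\mathbf S')$ is the category of isomorphic copies of topologically closed (possibly empty) substructures of powers of $\mathbf S'$ over non-empty index sets; relations, operations and partial operations (including domains) are coordinatewise, and substructures are closed under operations and partial operations wherever defined. Morphisms are continuous maps preserving relations, operations, and partial operations (including their domains). For $A\in\mathcal A$, $D(A)=\mathcal A(A,\mathbb S)$ as a closed substructure of $\mathbf S'^A$; for $X\in\mathcal X'$, $E(X)=\mathcal X'(X,\mathbf S')$ as a subalgebra of $\mathbb S^X$. $\mathbf S'$ yields a duality on $\mathcal A$ if every evaluation map $e_A:A\to ED(A)$, $e_A(a)(x)=x(a)$, is an isomorphism; a full duality if moreover every evaluation map $\varepsilon_X:X\to DE(X)$, $\varepsilon_X(x)(f)=f(x)$ $(X\in\mathcal X')$, is an isomorphism; a strong duality if moreover $\mathbf S'$ is injective in $\mathcal X'$ (every morphism to $\mathbf S'$ from a closed substructure of an object of $\mathcal X'$ extends to the whole object). *)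

(* Defs.v *)
From HB Require Import structures.
From mathcomp Require Import all_boot all_algebra.
From mathcomp Require Import all_classical topology.

Set Implicit Arguments.
Unset Strict Implicit.
Unset Printing Implicit Defensive.

Import GRing.Theory.
Local Open Scope classical_set_scope.
Local Open Scope ring_scope.

Inductive S3 : Type := S0 | Sh | S1.

Definition S3_code (x : S3) : option bool :=
  match x with S0 => None | Sh => Some false | S1 => Some true end.
Definition S3_decode (o : option bool) : S3 :=
  match o with None => S0 | Some false => Sh | Some true => S1 end.
Lemma S3_codeK : cancel S3_code S3_decode. Proof. by case. Qed.

HB.instance Definition _ := Finite.copy S3 (can_type S3_codeK).

Definition S3_add (x y : S3) : S3 :=
  match x, y with
  | S0, z | z, S0 => z
  | S1, S1 | Sh, Sh => Sh
  | S1, Sh | Sh, S1 => S1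
  end.

(* minimum for the chain S0 < Sh < S1 *)
Definition S3_mul (x y : S3) : S3 :=
  match x, y with
  | S0, _ | _, S0 => S0
  | Sh, _ | _, Sh => Sh
  | S1, S1 => S1
  end.

Lemma S3_addA : associative S3_add. Proof. by case; case; case. Qed.
Lemma S3_addC : commutative S3_add. Proof. by case; case. Qed.
Lemma S3_add0 : left_id S0 S3_add. Proof. by case. Qed.
Lemma S3_mulA : associative S3_mul. Proof. by case; case; case. Qed.
Lemma S3_mul1 : left_id S1 S3_mul. Proof. by case. Qed.
Lemma S3_1mul : right_id S1 S3_mul. Proof. by case. Qed.
Lemma S3_mulDl : left_distributive S3_mul S3_add.
Proof. by case; case; case. Qed.
Lemma S3_mulDr : right_distributive S3_mul S3_add.
Proof. by case; case; case. Qed.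
Lemma S3_mul0 : left_zero S0 S3_mul. Proof. by case. Qed.
Lemma S3_0mul : right_zero S0 S3_mul. Proof. by case. Qed.

HB.instance Definition _ := GRing.isPzSemiRing.Build S3
  S3_addA S3_addC S3_add0 S3_mulA S3_mul1 S3_1mul S3_mulDl S3_mulDr
  S3_mul0 S3_0mul.

HB.instance Definition _ := hasNbhs.Build S3 principal_filter.
HB.instance Definition _ := Discrete_ofNbhs.Build S3 erefl.

(* Algebras of the type (+, *, 0, 1) of S are taken to be semirings; all members
   of ISP(S) are semirings, and possibly trivial ones, hence pzSemiRingType. *)

Definition spower (I : Type) : Type := I -> S3.

Section SPower.
Variable I : Type.
Implicit Types f g h : spower I.

HB.instance Definition _ := Choice.copy (spower I) (I -> S3).

Let addA : associative (fun f g : spower I => (fun i => f i + g i) : spower I).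
Proof. by move=> f g h; apply/funext => i; rewrite addrA. Qed.
Let addC : commutative (fun f g : spower I => (fun i => f i + g i) : spower I).
Proof. by move=> f g; apply/funext => i; rewrite addrC. Qed.
Let add0 : left_id ((fun=> 0) : spower I) (fun f g => (fun i => f i + g i)).
Proof. by move=> f; apply/funext => i; rewrite add0r. Qed.
Let mulA : associative (fun f g : spower I => (fun i => f i * g i) : spower I).
Proof. by move=> f g h; apply/funext => i; rewrite mulrA. Qed.
Let mul1 : left_id ((fun=> 1) : spower I) (fun f g => (fun i => f i * g i)).
Proof. by move=> f; apply/funext => i; rewrite mul1r. Qed.
Let mul1' : right_id ((fun=> 1) : spower I) (fun f g => (fun i => f i * g i)).
Proof. by move=> f; apply/funext => i; rewrite mulr1. Qed.
Let mulDl : left_distributive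
  (fun f g : spower I => (fun i => f i * g i) : spower I)
  (fun f g => (fun i => f i + g i)).
Proof. by move=> f g h; apply/funext => i; rewrite mulrDl. Qed.
Let mulDr : right_distributive
  (fun f g : spower I => (fun i => f i * g i) : spower I)
  (fun f g => (fun i => f i + g i)).
Proof. by move=> f g h; apply/funext => i; rewrite mulrDr. Qed.
Let mul0 : left_zero ((fun=> 0) : spower I) (fun f g => (fun i => f i * g i)).
Proof. by move=> f; apply/funext => i; rewrite mul0r. Qed.
Let mul0' : right_zero ((fun=> 0) : spower I) (fun f g => (fun i => f i * g i)).
Proof. by move=> f; apply/funext => i; rewrite mulr0. Qed.

HB.instance Definition _ := GRing.isPzSemiRing.Build (spower I)
  addA addC add0 mulA mul1 mul1' mulDl mulDr mul0 mul0'.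

End SPower.

Definition is_hom (A B : pzSemiRingType) (f : A -> B) : Prop :=
  nmod_morphism f /\ monoid_morphism f.

Definition alg_iso (A B : pzSemiRingType) (f : A -> B) : Prop :=
  is_hom f /\ bijective f.

Definition subalgebra (A : pzSemiRingType) (B : set A) : Prop :=
  semiring_closed [pred x | x \in B].

(* An isomorphism onto a subalgebra of S^I is an injective homomorphism into
   S^I. The empty index set is allowed, so that the trivial algebra belongs to
   the quasi-variety. *)
Definition in_ISP (A : pzSemiRingType) : Prop :=
  exists (I : Type) (f : A -> spower I), is_hom f /\ injective f.

(* Operations and partial operations are treated alike: a total operation is one
   whose domain is everything. *)
Record signature := Signature {
  rel_idx : Type;
  rel_ar : rel_idx -> nat;
  op_idx : Type;
  op_ar : op_idx -> nat }.

(* [op o v w] means that the partial operation o is defined at v with value w. *)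
Record structure (L : signature) := Structure {
  carrier :> topologicalType;
  rel : forall r : rel_idx L, set ('I_(rel_ar r) -> carrier);
  op : forall o : op_idx L, ('I_(op_ar o) -> carrier) -> carrier -> Prop;
  op_functional : forall o (v : 'I_(op_ar o) -> carrier) w w',
    op v w -> op v w' -> w = w' }.
Arguments rel {L} s r _.
Arguments op {L} s o _ _.

Section Structures.
Variable L : signature.
Implicit Types X Y : structure L.

Definition morphism X Y (f : X -> Y) : Prop :=
  [/\ continuous f,
      forall r v, rel X r v -> rel Y r (f \o v) &
      forall o v w, op X o v w -> op Y o (f \o v) (f w)].

Definition iso X Y (f : X -> Y) : Prop :=
  morphism f /\
  exists g : Y -> X, [/\ morphism g, cancel f g & cancel g f].

Section Power.
Variables (X : structure L) (I : Type).

Definition power_rel (r : rel_idx L) : set ('I_(rel_ar r) -> (I -> X)) :=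
  [set v | forall i, rel X r (fun k => v k i)].
Definition power_op (o : op_idx L) (v : 'I_(op_ar o) -> (I -> X)) (w : I -> X) :=
  forall i, op X o (fun k => v k i) (w i).

Lemma power_op_functional o v w w' :
  power_op (o := o) v w -> power_op v w' -> w = w'.
Proof.
by move=> vw vw'; apply/funext => i; exact: op_functional (vw i) (vw' i).
Qed.

Definition power : structure L :=
  @Structure L (prod_topology (fun _ : I => X)) power_rel power_op
    power_op_functional.

End Power.

Record substructure X := Substructure {
  sub_set :> set X;
  sub_op_closed : forall o v w,
    (forall k, sub_set (v k)) -> op X o v w -> sub_set w }.

Section Sub.
Variables (X : structure L) (C : substructure X).

Definition sub_rel (r : rel_idx L) : set ('I_(rel_ar r) -> set_type C) :=
  [set v | rel X r (fun k => val (v k))].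
Definition sub_op (o : op_idx L) (v : 'I_(op_ar o) -> set_type C)
    (w : set_type C) := op X o (fun k => val (v k)) (val w).

Lemma sub_op_functional o v w w' :
  sub_op (o := o) v w -> sub_op v w' -> w = w'.
Proof. by move=> vw vw'; apply: val_inj; exact: op_functional vw vw'. Qed.

(* [set_type C] carries the subspace topology. By [sub_op_closed], the domain of
   the restricted operation is the whole trace on C of the original domain. *)
Definition sub : structure L :=
  @Structure L (set_type C) sub_rel sub_op sub_op_functional.

End Sub.

(* The class IS_cP^+(X0): the index set has to be non-empty, whereas the
   substructure may be empty. *)
Definition in_IScP X0 X : Prop :=
  exists (I : Type) (C : substructure (power X0 I)),
    [/\ inhabited I, closed C & exists f : X -> sub C, iso f].

End Structures.

(* For the functional relation g, this says that g is a homomorphism to S from a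
   subalgebra of S^n, the domain of g. *)
Definition partial_hom n (g : spower 'I_n -> S3 -> Prop) : Prop :=
  [/\ g 0 0, g 1 1,
      forall v w a b, g v a -> g w b -> g (v + w) (a + b) &
      forall v w a b, g v a -> g w b -> g (v * w) (a * b)].

Record alter_ego := AlterEgo {
  sig : signature;
  ego_rel : forall r : rel_idx sig, set ('I_(rel_ar r) -> S3);
  ego_op : forall o : op_idx sig, ('I_(op_ar o) -> S3) -> S3 -> Prop;
  ego_op_functional : forall o (v : 'I_(op_ar o) -> S3) w w',
    ego_op v w -> ego_op v w' -> w = w';
  ego_rel_algebraic : forall r, @subalgebra (spower 'I_(rel_ar r)) (@ego_rel r);
  ego_op_algebraic : forall o, partial_hom (@ego_op o) }.
Arguments ego_rel a r _ : clear implicits.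
Arguments ego_op a o _ _ : clear implicits.

Definition ego (M : alter_ego) : structure (sig M) :=
  @Structure (sig M) S3 (ego_rel M) (ego_op M)
    (@ego_op_functional M).

Section Delete.
Variable M : alter_ego.

Definition delete_rel (r0 : rel_idx (sig M)) : alter_ego :=
  @AlterEgo
    (@Signature {r : rel_idx (sig M) | r <> r0} (fun r => rel_ar (sval r))
       (op_idx (sig M)) (@op_ar (sig M)))
    (fun r => ego_rel M (sval r)) (ego_op M) (@ego_op_functional M)
    (fun r => ego_rel_algebraic (sval r)) (@ego_op_algebraic M).

Definition delete_op (o0 : op_idx (sig M)) : alter_ego :=
  @AlterEgo
    (@Signature (rel_idx (sig M)) (@rel_ar (sig M))
       {o : op_idx (sig M) | o <> o0} (fun o => op_ar (sval o)))
    (ego_rel M) (fun o => ego_op M (sval o))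
    (fun o => @ego_op_functional M (sval o))
    (@ego_rel_algebraic M) (fun o => ego_op_algebraic (sval o)).

End Delete.

Section Functors.
Variable M : alter_ego.

Section D.
Variable A : pzSemiRingType.

Definition homs_set : set (power (ego M) A) := [set x : A -> S3 | is_hom x].

Lemma homs_op_closed o v w :
  (forall k, homs_set (v k)) -> op (power (ego M) A) o v w -> homs_set w.
Proof.
move=> vhom vw; have [g0 g1 gD gM] := ego_op_algebraic o.
split; split.
- apply: op_functional (vw 0) _ => /=.
  rewrite (_ : (fun k => v k 0) = (0 : spower _)) //; apply/funext => k.
  by have [[->]] := vhom k.
- move=> a b; apply: op_functional (vw (a + b)) _ => /=.
  rewrite (_ : (fun k => v k (a + b)) =
    ((fun k => v k a) : spower _) + ((fun k => v k b) : spower _)).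
    exact: gD (vw a) (vw b).
  by apply/funext => k; have [[_ ->]] := vhom k.
- apply: op_functional (vw 1) _ => /=.
  rewrite (_ : (fun k => v k 1) = (1 : spower _)) //; apply/funext => k.
  by have [_ [->]] := vhom k.
- move=> a b; apply: op_functional (vw (a * b)) _ => /=.
  rewrite (_ : (fun k => v k (a * b)) =
    ((fun k => v k a) : spower _) * ((fun k => v k b) : spower _)).
    exact: gM (vw a) (vw b).
  by apply/funext => k; have [_ [_ ->]] := vhom k.
Qed.

Definition homs : substructure (power (ego M) A) := Substructure homs_op_closed.

Definition D : structure (sig M) := sub homs.

End D.

Section E.
Variable X : structure (sig M).

Definition morphisms : {pred spower X} :=
  fun f => `[< morphism (f : X -> ego M) >].

Lemma continuous_pointwise (m : S3 -> S3 -> S3) (f g : X -> S3) :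
  continuous f -> continuous g -> continuous (fun x => m (f x) (g x)).
Proof.
move=> cf cg x U /=; rewrite nbhs_principalE => /principal_filterP Ux.
have nf : \forall y \near x, f y = f x.
  exact: (cf x [set f x] (discrete_set1 (f x))).
have ng : \forall y \near x, g y = g x.
  exact: (cg x [set g x] (discrete_set1 (g x))).
by apply: filterS (filterI nf ng) => y [/= -> ->].
Qed.

Lemma morphisms_closed : semiring_closed morphisms.
Proof.
have relP r : @subalgebra (spower _) (ego_rel M r) := @ego_rel_algebraic M r.
have opP o := @ego_op_algebraic M o.
split; split.
- apply/asboolP; split.
  + exact: cst_continuous.
  + by move=> r v _; have [[/set_mem]] := relP r.
  + by move=> o v w _; have [] := opP o.
- move=> f g /asboolP[cf rf of_] /asboolP[cg rg og]; apply/asboolP; split.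
  + exact: continuous_pointwise.
  + move=> r v vr; have [[_ rD] _] := relP r.
    exact: set_mem (rD (f \o v) (g \o v) (mem_set (rf _ _ vr))
                     (mem_set (rg _ _ vr))).
  + by move=> o v w vw; have [_ _ oD _] := opP o; apply: oD;
      [exact: of_|exact: og].
- apply/asboolP; split.
  + exact: cst_continuous.
  + by move=> r v _; have [_ [/set_mem]] := relP r.
  + by move=> o v w _; have [] := opP o.
- move=> f g /asboolP[cf rf of_] /asboolP[cg rg og]; apply/asboolP; split.
  + exact: continuous_pointwise.
  + move=> r v vr; have [_ [_ rM]] := relP r.
    exact: set_mem (rM (f \o v) (g \o v) (mem_set (rf _ _ vr))
                     (mem_set (rg _ _ vr))).
  + by move=> o v w vw; have [_ _ _ oM] := opP o; apply: oM;
      [exact: of_|exact: og].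
Qed.

HB.instance Definition _ :=
  GRing.isSemiringClosed.Build (spower X) morphisms morphisms_closed.

Definition E : Type := {f : spower X | f \in morphisms}.

HB.instance Definition _ := SubChoice.on E.
HB.instance Definition _ :=
  GRing.SubChoice_isSubPzSemiRing.Build (spower X) morphisms E morphisms_closed.

End E.

Section EvaluationA.
Variable A : pzSemiRingType.

Definition eval_alg_fun (a : A) : spower (D A) := fun x => val x a.

Lemma eval_alg_morphism a : eval_alg_fun a \in @morphisms (D A).
Proof.
apply/asboolP; split.
- move=> x.
  apply: (@continuous_comp (D A) (power (ego M) A) (ego M) val
            (@proj A (fun=> S3) a)).
  + exact: initial_continuous.
  + exact: (@proj_continuous A (fun=> S3) a).
- by move=> r v; apply.
- by move=> o v w; apply.
Qed.

Definition eval_alg (a : A) : E (D A) :=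
  Sub (eval_alg_fun a) (eval_alg_morphism a).

End EvaluationA.

Section EvaluationX.
Variable X : structure (sig M).

Definition eval_str_fun (x : X) : power (ego M) (E X) := fun f => val f x.

Lemma eval_str_hom x : homs_set (A := E X) (eval_str_fun x).
Proof. by split; split. Qed.

Definition eval_str (x : X) : D (E X) :=
  Sub (eval_str_fun x) (mem_set (eval_str_hom x)).

End EvaluationX.

Definition duality : Prop :=
  forall A : pzSemiRingType, in_ISP A -> alg_iso (@eval_alg A).

Definition full_duality : Prop :=
  duality /\
  forall X : structure (sig M), in_IScP (ego M) X -> iso (@eval_str X).

Definition injective_ego : Prop :=
  forall X : structure (sig M), in_IScP (ego M) X ->
  forall C : substructure X, closed C ->
  forall f : sub C -> ego M, morphism f ->
  exists2 g : X -> ego M, morphism g & forall y : sub C, g (val y) = f y.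

Definition strong_duality : Prop := full_duality /\ injective_ego.

End Functors.

Definition r2 : set ('I_2 -> S3) :=
  [set v | (v ord0, v ord_max) <> (Sh, S0) /\ (v ord0, v ord_max) <> (S1, S0)].

Definition lambda1 (x y : S3) : option S3 :=
  match x, y with
  | S1, S0 => None
  | S0, S0 => Some S0
  | Sh, Sh => Some Sh
  | S1, S1 => Some S1
  | S0, Sh => Some Sh
  | S0, S1 => Some Sh
  | Sh, S0 => Some S0
  | Sh, S1 => Some Sh
  | S1, Sh => Some S1
  end.

Definition lambda1_graph (v : 'I_2 -> S3) (w : S3) : Prop :=
  lambda1 (v ord0) (v ord_max) = Some w.

Lemma lambda1_functional v w w' :
  lambda1_graph v w -> lambda1_graph v w' -> w = w'.
Proof. by rewrite /lambda1_graph => -> []. Qed.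

Lemma r2_algebraic : @subalgebra (spower 'I_2) r2.
Proof.
split; split.
- by apply/mem_set; split.
- move=> v w /set_mem rv /set_mem rw; apply/mem_set; move: rv rw.
  rewrite /r2 /= [(v + w) ord0]/GRing.add [(v + w) ord_max]/GRing.add /=.
  by case: (v ord0) (v ord_max) (w ord0) (w ord_max)
    => [] [] [] [] //= [] ? ? [] ? ?; split.
- by apply/mem_set; split.
- move=> v w /set_mem rv /set_mem rw; apply/mem_set; move: rv rw.
  rewrite /r2 /= [(v * w) ord0]/GRing.mul [(v * w) ord_max]/GRing.mul /=.
  by case: (v ord0) (v ord_max) (w ord0) (w ord_max)
    => [] [] [] [] //= [] ? ? [] ? ?; split.
Qed.

Lemma lambda1_algebraic : partial_hom lambda1_graph.
Proof.
rewrite /lambda1_graph; split=> // v w a b.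
- rewrite [(v + w) ord0]/GRing.add [(v + w) ord_max]/GRing.add /=.
  by case: (v ord0) (v ord_max) (w ord0) (w ord_max)
    => [] [] [] [] //= [<-] [<-].
- rewrite [(v * w) ord0]/GRing.mul [(v * w) ord_max]/GRing.mul /=.
  by case: (v ord0) (v ord_max) (w ord0) (w ord_max)
    => [] [] [] [] //= [<-] [<-].
Qed.

Definition S_os : alter_ego :=
  @AlterEgo (@Signature unit (fun=> 2) unit (fun=> 2))
    (fun=> r2) (fun=> lambda1_graph) (fun=> lambda1_functional)
    (fun=> r2_algebraic) (fun=> lambda1_algebraic).

(* Main.v *)
(* Write x = (d x, p x) for x in S, with d x the truth value of x <> 0 and p x
   that of x = 1; d is a homomorphism onto the two-element chain, p one onto
   F_2, and p <= d. Then r2 (x, y) says d x <= d y, and lambda1 (x, y) is the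
   element (d y, p x), defined exactly when p x <= d y.

   Duality and injectivity: a Stone-Weierstrass argument in the lattice
   operations x y and x + y + x y reduces the statement that a morphism f is
   given by an algebra element to pairs of points. For a pair, (f x, f y) lies
   in the subalgebra of S^2 traced out by the algebra because the subalgebras
   of S^2 are cut out by d x <= d y, p x <= d y, p x = p y and their converses,
   all of which f preserves.

   Fullness: for a homomorphism psi on E(X), compactness gives u and v in X with
   p (g u) = p (psi g) and d (g v) = d (psi g) for all g, and lambda1 (u, v) is
   then the point at which psi evaluates.

   Optimality: 0, h, 1 |-> h, 0, 0 preserves lambda1 but not r2, and
   0, h, 1 |-> 0, 1, 1 preserves r2 but not lambda1; each would be a term
   function if the reduced structure yielded a duality. *)

From mathcomp Require Import all_boot all_algebra.
From mathcomp Require Import all_classical topology.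
Require Import Defs.

Set Implicit Arguments.
Unset Strict Implicit.
Unset Printing Implicit Defensive.

Import GRing.Theory.
Local Open Scope classical_set_scope.
Local Open Scope ring_scope.

(** * Compactness and continuity in powers and substructures *)

(** The sets [Z i] are a base of a proper filter; a cluster point of it lies in each of them by
    closedness. *)
Lemma compact_directed (T : topologicalType) (I : Type) (P : set I)
    (Z : I -> set T) :
  compact [set: T] -> P !=set0 -> (forall i, P i -> closed (Z i)) ->
  (forall i, P i -> Z i !=set0) ->
  (forall i j, P i -> P j -> exists2 k, P k & Z k `<=` Z i `&` Z j) ->
  exists x, forall i, P i -> Z i x.
Proof.
move=> cT P0 Zcl Z0 Zdir.
have FF : ProperFilter (filter_from P Z).
  by apply: filter_from_proper => //; apply: filter_from_filter.
have [x [_ xcl]] := cT _ FF filterT.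
exists x => i Pi; apply: (Zcl i Pi) => B nB.
by apply: xcl nB; exists i.
Qed.

Lemma compact_set_type (T : topologicalType) (C : set T) :
  compact [set: T] -> closed C -> compact [set: set_type C].
Proof.
move=> cT Ccl F FF _.
have cC : compact C by exact: subclosed_compact Ccl cT _.
have [|x [Cx xcl]] := cC (val @ F) _.
  rewrite /= nbhs_filterE; apply: (@filterS _ _ _ setT) filterT => z _.
  exact: set_valP.
exists (Sub x (mem_set Cx)); split=> // A B FA [_ [[U oU <-] /= Ux] UB].
have [||y [[z Az <-] Uz]] := xcl (val @` A) U.
- by rewrite /= nbhs_filterE; apply: (@filterS _ F _ A) FA => z Az; exists z.
- exact: open_nbhs_nbhs.
- by exists z; split=> //; exact: UB.
Qed.

Lemma continuous_sub (L : signature) (X : structure L) (C : substructure X)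
    (Y : topologicalType) (f : Y -> sub C) :
  continuous (fun y => val (f y) : X) -> continuous f.
Proof.
move=> /continuousP fc; apply/continuousP => _ [U oU <-].
exact: fc.
Qed.

Lemma continuous_power (L : signature) (X : structure L) (I : Type)
    (Y : topologicalType) (f : Y -> power X I) :
  (forall i, continuous (fun y => f y i : X)) -> continuous f.
Proof.
move=> fc y; apply/cvg_sup => i A [_ [[U oU <-] Ufy] UA].
by apply: filterS UA _; apply: fc; exact: open_nbhs_nbhs.
Qed.

Lemma continuous_coord (L : signature) (X : structure L) (I : Type) (i : I) :
  continuous (fun x : power X I => x i : X).
Proof. exact: (@proj_continuous {classic I} (fun=> X) i). Qed.

Lemma continuous_val (L : signature) (X : structure L) (C : substructure X) :
  continuous (val : sub C -> X).
Proof. exact: initial_continuous. Qed.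

Lemma compact_power (L : signature) (X : structure L) (I : Type) :
  compact [set: X] -> compact [set: power X I].
Proof.
move=> cX.
have := @tychonoff {classic I} (fun=> X) (fun=> setT) (fun=> cX).
by rewrite (_ : [set f | _] = setT) // eqEsubset; split.
Qed.

(** As [S3] is discrete, [f] and [g] are locally constant, so every condition on their values is
    clopen. *)
Lemma closed_rel_S3 (X : topologicalType) (Q : S3 -> S3 -> Prop)
    (f g : X -> S3) :
  continuous f -> continuous g -> closed [set x | Q (f x) (g x)].
Proof.
move=> fc gc; rewrite -[X in closed X]setCK; apply: open_closedC.
rewrite openE => x /= Qx.
have nf : nbhs x (f @^-1` [set f x]) by exact: fc (discrete_set1 _).
have ng : nbhs x (g @^-1` [set g x]) by exact: gc (discrete_set1 _).
by apply: filterS (filterI nf ng) => y [/= -> ->].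
Qed.

(** * Embeddings, without topology *)

Section Embeddings.
Variable L : signature.

Definition embedding (X Y : structure L) (f : X -> Y) : Prop :=
  [/\ injective f,
      forall r v, rel Y r (f \o v) -> rel X r v &
      forall o v u, op Y o (f \o v) u -> exists2 w, op X o v w & f w = u].

Lemma embedding_comp (X Y Z : structure L) (f : X -> Y) (g : Y -> Z) :
  embedding f -> embedding g -> embedding (g \o f).
Proof.
move=> [finj frel fop] [ginj grel gop]; split.
- exact: inj_comp.
- by move=> r v gfv; apply: frel; apply: grel.
- move=> o v u /gop[w /fop[w' vw' <-] <-].
  by exists w'.
Qed.

Lemma embedding_val (X : structure L) (C : substructure X) :
  embedding (val : sub C -> X).
Proof.
split=> // o v u vu.
have Cu : sub_set C u by apply: sub_op_closed vu => k; exact: set_valP.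
by exists (Sub u (mem_set Cu)).
Qed.

Lemma embedding_iso (X Y : structure L) (f : X -> Y) : iso f -> embedding f.
Proof.
move=> [fm [g [[_ grel gop] fK gK]]]; split.
- exact: can_inj fK.
- move=> r v /grel; congr (rel X r _).
  by apply/funext => k /=; rewrite fK.
- move=> o v u /gop vu; exists (g u) => //.
  rewrite (_ : v = g \o (f \o v)) //.
  by apply/funext => k /=; rewrite fK.
Qed.

End Embeddings.

(** * Evaluation maps for an arbitrary alter ego *)

Section AlterEgo.
Variable M : alter_ego.
Implicit Types X : structure (sig M).

Lemma compact_ego : compact [set: ego M].
Proof.
by apply: finite_compact; exact: (@finite_finset S3).
Qed.

Lemma E_morphism X (g : E X) : morphism (val g : X -> ego M).
Proof. by case: g => g /= /asboolP. Qed.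

Lemma E_of_morphism X (f : X -> ego M) :
  morphism f -> exists g : E X, val g = f.
Proof. by move=> fm; exists (Sub f (asboolT fm)). Qed.

Lemma coord_morphism X (I : Type) (C : substructure (power (ego M) I))
    (f : X -> sub C) (i : I) :
  morphism f -> morphism (fun x => val (f x) i : ego M).
Proof.
move=> [fc frel fop]; split.
- move=> x; apply: (@continuous_comp X (sub C) (ego M) f (fun c => val c i)).
    exact: fc.
  apply: (@continuous_comp (sub C) (power (ego M) I) (ego M) val
     (fun c => c i)); first exact: continuous_val.
  exact: continuous_coord.
- by move=> r v /frel; apply.
- by move=> o v w /fop; apply.
Qed.

Lemma eval_str_morphism X : morphism (@eval_str M X).
Proof.
split.
- apply: continuous_sub; apply: continuous_power => g.
  by have [] := E_morphism g.
- by move=> r v vr g; have [_ + _] := E_morphism g; apply.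
- by move=> o v w vw g; have [_ _ +] := E_morphism g; apply.
Qed.

Section IScP.
Variables (X : structure (sig M)) (I : Type).
Variables (C : substructure (power (ego M) I)) (f : X -> sub C).
Hypothesis fiso : iso f.

(** The coordinates of the given copy of [X] in a power belong to [E X]; hence whatever holds under
    all of [E X] holds in [X]. *)
Lemma eval_str_embedding : embedding (@eval_str M X).
Proof.
have [fm [g [[_ grel gop] fK gK]]] := fiso.
have coordP i : exists p : E X, val p = (fun x => val (f x) i).
  exact: E_of_morphism (coord_morphism i fm).
have [finj frel fop] := embedding_comp (embedding_iso fiso) (embedding_val C).
split.
- move=> x y xy; apply: finj; apply/funext => i /=.
  have [p pE] := coordP i.
  have /(congr1 (fun u => val u p)) := xy.
  by rewrite /= /eval_str_fun pE.
- move=> r v rv; apply: frel => i; have [p pE] := coordP i.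
  by have := rv p; rewrite /= /eval_str_fun pE.
- move=> o v u vu.
  have [p pE] := choice coordP.
  have [|w vw _] := fop o v (fun i => val u (p i)).
    by move=> i; have := vu (p i); rewrite /= /eval_str_fun pE.
  exists w => //; have [_ _ eop] := eval_str_morphism X.
  exact: op_functional (eop _ _ _ vw) vu.
Qed.

(** Through the same coordinates, the topology of [X] is initial for [E X]. *)
Lemma continuous_IScP (Y : topologicalType) (h : Y -> X) :
  (forall e : E X, continuous (fun y => val e (h y))) -> continuous h.
Proof.
move=> hc; have [fm [g [[gc _ _] fK gK]]] := fiso.
have fhc : continuous (f \o h).
  apply: continuous_sub; apply: continuous_power => i.
  have [p pE] := E_of_morphism (coord_morphism i fm).
  by have := hc p; rewrite pE.
rewrite (_ : h = g \o (f \o h)); last by apply/funext => y /=; rewrite fK.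
by move=> y; apply: continuous_comp; [exact: fhc|exact: gc].
Qed.

Lemma compact_IScP : closed C -> compact [set: X].
Proof.
move=> Ccl; have [_ [g [[gc _ _] fK gK]]] := fiso.
have cC : compact [set: sub C].
  by apply: compact_set_type => //; apply: compact_power; exact: compact_ego.
rewrite (_ : [set: X] = g @` setT).
  by apply: continuous_compact cC; exact: continuous_subspaceT.
by rewrite eqEsubset; split=> // x _; exists (f x) => //=; rewrite fK.
Qed.

(** Only surjectivity is left to check: the embedding property makes the inverse preserve relations
    and operations. *)
Lemma eval_str_iso :
  (forall u : E X -> S3, is_hom u -> exists x, forall g, val g x = u g) ->
  iso (@eval_str M X).
Proof.
move=> surj; split; first exact: eval_str_morphism.
have [inj erel eop] := eval_str_embedding.
have /choice[h hK] (u : D M (E X)) : exists x, eval_str x = u.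
  have [x xE] := surj _ (set_valP u).
  by exists x; apply: val_inj; apply/funext.
have Kh : cancel (@eval_str M X) h by move=> x; apply: inj; rewrite hK.
exists h; split=> //; split.
- apply: continuous_IScP => e.
  rewrite (_ : (fun _ => _) = fun u : D M (E X) => val u e).
    by have [] := E_morphism (eval_alg M e).
  by apply/funext => u; rewrite -[in RHS](hK u).
- move=> r v vr; apply: erel; congr (rel _ r _): vr.
  by apply/funext => k /=; rewrite hK.
- move=> o v u vu.
  have [|w vw wu] := eop o (h \o v) u.
    by congr (op _ o _ _): vu; apply/funext => k /=; rewrite hK.
  by rewrite -wu Kh.
Qed.

End IScP.

(** * The dual of an algebra *)

Lemma closed_homs (A : pzSemiRingType) : closed (sub_set (homs M A)).
Proof.
have c0 (a : A) : continuous (fun x : power (ego M) A => x a : S3).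
  exact: continuous_coord.
rewrite (_ : sub_set (homs M A) =
  [set x : power (ego M) A | x 0 = 0 :> S3] `&` [set x | x 1 = 1 :> S3] `&`
  \bigcap_(p : A * A) [set x | x (p.1 + p.2) = (x p.1 : S3) + x p.2] `&`
  \bigcap_(p : A * A) [set x | x (p.1 * p.2) = (x p.1 : S3) * x p.2]).
  repeat apply: closedI.
  - by apply: (@closed_rel_S3 _ eq) => //; exact: cst_continuous.
  - by apply: (@closed_rel_S3 _ eq) => //; exact: cst_continuous.
  - apply: closed_bigI => p _; apply: (@closed_rel_S3 _ eq) => //.
    exact: (@continuous_pointwise M (power (ego M) A) +%R).
  - apply: closed_bigI => p _; apply: (@closed_rel_S3 _ eq) => //.
    exact: (@continuous_pointwise M (power (ego M) A) *%R).
rewrite eqEsubset; split=> x.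
  move=> [[x0 xD] [x1 xM]].
  by split; [split; [split|]|] => // p _; [exact: xD|exact: xM].
move=> [[[x0 x1] xD] xM]; split; split=> //.
  by move=> a b; exact: (xD (a, b)).
by move=> a b; exact: (xM (a, b)).
Qed.

Lemma compact_D (A : pzSemiRingType) : compact [set: D M A].
Proof.
apply: compact_set_type; last exact: closed_homs.
by apply: compact_power; exact: compact_ego.
Qed.

Lemma eval_alg_hom (A : pzSemiRingType) : is_hom (@eval_alg M A).
Proof.
have homP (x : D M A) : is_hom (val x : A -> S3) by exact: set_valP x.
split; (split; last move=> a b); apply: val_inj; apply/funext => x;
  have [[x0 xD] [x1 xM]] := homP x.
- exact: x0.
- exact: xD.
- exact: x1.
- exact: xM.
Qed.

(** The coordinates of an embedding of [A] into a power of S are points of [D M A] and separate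
    elements. *)
Lemma eval_alg_inj (A : pzSemiRingType) : in_ISP A -> injective (@eval_alg M A).
Proof.
move=> [I [f [[[f0 fD] [f1 fM]] finj]]] a b ab; apply: finj; apply/funext => i.
have hx : @homs_set M A (fun a => f a i).
  split; split.
  - by rewrite f0.
  - by move=> c d; rewrite fD.
  - by rewrite f1.
  - by move=> c d; rewrite fM.
pose x : D M A := Sub (f^~ i : power (ego M) A) (mem_set hx).
exact: (congr1 (fun g : E (D M A) => val g x) ab).
Qed.

Lemma eval_alg_iso (A : pzSemiRingType) : in_ISP A ->
  (forall f : D M A -> ego M, morphism f ->
     exists a, forall x, val x a = f x) ->
  alg_iso (@eval_alg M A).
Proof.
move=> AS surj; split; first exact: eval_alg_hom.
have /choice[g gK] (f : E (D M A)) : exists a, eval_alg M a = f.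
  have [a aE] := surj _ (E_morphism f).
  by exists a; apply: val_inj; apply/funext.
exists g => // a; apply: (eval_alg_inj AS); exact: gK.
Qed.

End AlterEgo.

(** * Interpolation of morphisms on a compact structure *)

Definition pair2 (T : Type) (x y : T) : 'I_2 -> T :=
  fun k => if k == ord0 then x else y.

Lemma comp_pair2 (T U : Type) (f : T -> U) (x y : T) :
  f \o pair2 x y = pair2 (f x) (f y).
Proof. by apply/funext => k /=; rewrite /pair2; case: eqP. Qed.

Section StoneWeierstrass.
Variables (X : structure (sig S_os)) (A : pzSemiRingType).
Variable phi : X -> power (ego S_os) A.
Hypothesis cX : compact [set: X].
Hypothesis phi_hom : forall x, is_hom (phi x : A -> S3).
Hypothesis phi_cont : forall a, continuous (fun x => phi x a : S3).
Hypothesis phi_emb : embedding phi.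
Variable f : X -> S3.
Hypothesis fm : morphism (f : X -> ego S_os).

Let phi0 x : phi x 0 = S0. Proof. by have [[]] := phi_hom x. Qed.
Let phi1 x : phi x 1 = S1. Proof. by have [_ []] := phi_hom x. Qed.
Let phiD x a b : phi x (a + b) = S3_add (phi x a) (phi x b).
Proof. by have [[_ xD] _] := phi_hom x; exact: xD. Qed.
Let phiM x a b : phi x (a * b) = S3_mul (phi x a) (phi x b).
Proof. by have [_ [_ xM]] := phi_hom x; exact: xM. Qed.

Let preserves_r2 x y :
  (forall a, r2 (pair2 (phi x a) (phi y a))) -> r2 (pair2 (f x) (f y)).
Proof.
have [_ erel _] := phi_emb; have [_ frel _] := fm => xy.
rewrite -comp_pair2; apply: (frel tt); apply: (erel tt) => a /=.
by have := xy a; rewrite -(comp_pair2 (phi^~ a)).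
Qed.

(** The coordinatewise value of [lambda1] is the image of a point [w], because [phi] is an
    embedding. *)
Let preserves_lambda1 x y : (forall a, lambda1 (phi x a) (phi y a) <> None) ->
  exists2 w, lambda1 (f x) (f y) = Some (f w) &
    forall a, lambda1 (phi x a) (phi y a) = Some (phi w a).
Proof.
move=> xy; have [_ _ eop] := phi_emb; have [_ _ fop] := fm.
have /choice[u uE] a : exists s, lambda1 (phi x a) (phi y a) = Some s.
  by case: lambda1 (xy a) => // s _; exists s.
have [|w xyw wu] := eop tt (pair2 x y) u.
  by move=> a /=; exact: uE.
exists w; first exact: (fop tt _ _ xyw).
by move=> a; rewrite wu.
Qed.

(* Baker-Pixley for the pair: a pair outside a subalgebra of S^2 is excluded by
   r2, by the domain of lambda1, or by the relation {lambda1 (x, y) = y}. *)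
Let interpolate2 x y : exists a, phi x a = f x /\ phi y a = f y.
Proof.
pose B s t := exists a, phi x a = s /\ phi y a = t.
have BD s t s' t' : B s t -> B s' t' -> B (S3_add s s') (S3_add t t').
  by move=> [a [<- <-]] [b [<- <-]]; exists (a + b); rewrite !phiD.
have BM s t s' t' : B s t -> B s' t' -> B (S3_mul s s') (S3_mul t t').
  by move=> [a [<- <-]] [b [<- <-]]; exists (a * b); rewrite !phiM.
have B00 : B S0 S0 by exists 0; rewrite !phi0.
have B11 : B S1 S1 by exists 1; rewrite !phi1.
have Bhh : B Sh Sh := BD _ _ _ _ B11 B11.
have Bphi a : B (phi x a) (phi y a) by exists a.
apply: contrapT; rewrite -/(B (f x) (f y)) => nB.
have dom : ~ B S1 S0 -> lambda1 (f x) (f y) <> None.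
  move=> n10; have [a|w ->//] := @preserves_lambda1 x y.
  by have := Bphi a; case: (phi x a) (phi y a) => [] [].
have dom' : ~ B S0 S1 -> lambda1 (f y) (f x) <> None.
  move=> n01; have [a|w ->//] := @preserves_lambda1 y x.
  by have := Bphi a; case: (phi x a) (phi y a) => [] [].
(* Multiplying by [(Sh, Sh)] turns [(S1, S0)] into [(Sh, S0)], so both pairs missing from [r2] are
   excluded. *)
have ler2 : ~ B Sh S0 -> r2 (pair2 (f x) (f y)).
  move=> nh0; apply: preserves_r2 => a.
  have n10 : ~ B S1 S0 by move=> /(BM _ _ _ _ Bhh).
  by have := Bphi a; case: (phi x a) (phi y a) => [] [] //; split.
have ger2 : ~ B S0 Sh -> r2 (pair2 (f y) (f x)).
  move=> n0h; apply: preserves_r2 => a.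
  have n01 : ~ B S0 S1 by move=> /(BM _ _ _ _ Bhh).
  by have := Bphi a; case: (phi x a) (phi y a) => [] [] //; split.
(* Adding [(S1, S1)] once or twice turns [(Sh, S1)], [(S0, S1)] and [(S1, S0)] into [(S1, Sh)].
   Without these pairs [lambda1] is the second projection, so the point it yields is [y]. *)
have samep : ~ B S1 Sh -> lambda1 (f x) (f y) = Some (f y).
  move=> n1h.
  have nh1 : ~ B Sh S1 by move=> /(BD _ _ _ _ B11).
  have n10 : ~ B S1 S0 by move=> /(BD _ _ _ _ B11).
  have n01 : ~ B S0 S1 by move=> /(BD _ _ _ _ B11).
  have xy a : lambda1 (phi x a) (phi y a) = Some (phi y a).
    by have := Bphi a; case: (phi x a) (phi y a) => [] [].
  have [a|w -> wE] := @preserves_lambda1 x y; first by rewrite xy.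
  congr (Some (f _)); have [einj _ _] := phi_emb; apply: einj.
  by apply/funext => a; have := wE a; rewrite xy => -[].
case: (f x) (f y) nB dom dom' ler2 ger2 samep
  => [] [] nB dom dom' ler2 ger2 samep //.
- by case: (ger2 nB).
- exact: dom'.
- by case: (ler2 nB).
- have : ~ B S1 Sh by move=> /(BD _ _ _ _ B11).
  by move=> /samep.
- exact: dom.
- by have := samep nB.
Qed.

(** [S3_mul s t = s] means s <= t. If every interpolant at [x] exceeded [f] somewhere, then,
    products directing the bad sets, they would all do so at a common [y], against
    [interpolate2 x y]. *)
Let interpolate_below x :
  exists2 a, phi x a = f x & forall z, S3_mul (phi z a) (f z) = phi z a.
Proof.
apply: contrapT => nex.
have [fc _ _] := fm.
have [|a xa|a xa|a b xa xb|y yP] := @compact_directed X A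
  [set a | phi x a = f x]
  (fun a => [set z | S3_mul (phi z a) (f z) <> phi z a]) cX.
- by have [a [xa _]] := interpolate2 x x; exists a.
- by apply: (@closed_rel_S3 _ (fun s t => S3_mul s t <> s)).
- apply: contrapT => /forallNP xNP; apply: nex; exists a => // z.
  by apply: contrapT => /xNP.
- exists (a * b) => /=; first by rewrite phiM xa xb; case: (f x).
  move=> z /=; rewrite phiM.
  by case: (phi z a) (phi z b) (f z) => [] [] [] // h; split=> // ?; apply: h.
- have [a [xa ya]] := interpolate2 x y.
  by apply: (yP a xa); rewrite ya; case: (f y).
Qed.

(** Dual compactness argument: the elements below [f] are directed by the join a + b + a b. The
    abstract [phi] serves both duality and injectivity. *)
Lemma interpolate : exists a, forall x, phi x a = f x.
Proof.
apply: contrapT => nex.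
have [fc _ _] := fm.
have [|a xa|a xa|a b xa xb|y yP] := @compact_directed X A
  [set a | forall z, S3_mul (phi z a) (f z) = phi z a]
  (fun a => [set z | phi z a <> f z]) cX.
- by exists 0 => z; rewrite phi0.
- by apply: (@closed_rel_S3 _ (fun s t => s <> t)).
- apply: contrapT => /forallNP xNP; apply: nex; exists a => z.
  by apply: contrapT => /xNP.
- exists (a + b + a * b) => z /=; rewrite !phiD !phiM.
    by case: (phi z a) (phi z b) (f z) (xa z) (xb z) => [] [] [].
  by case: (phi z a) (phi z b) (f z) (xa z) (xb z) => [] [] [].
- by have [a ya /yP] := interpolate_below y.
Qed.

End StoneWeierstrass.

(** * Homomorphisms on E(X) are evaluations *)

Section Evaluations.
Variable X : structure (sig S_os).
Local Notation EX := (E (M := S_os) X).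

Lemma S_os_hom_eval (psi : EX -> S3) :
  compact [set: X] -> embedding (@eval_str S_os X) -> is_hom psi ->
  exists x, forall g : EX, val g x = psi g.
Proof.
move=> cX [einj erel eop] [[psi0 psiD] [psi1 psiM]].
have gc (g : EX) : continuous (val g : X -> S3).
  by have [] := E_morphism g.
have D0 (g g' : EX) x :
  val (g + g') x = S3_add (val g x) (val g' x) by [].
have M0 (g g' : EX) x :
  val (g * g') x = S3_mul (val g x) (val g' x) by [].
have [|g gP|g gP|g g' gP g'P|u uP] := @compact_directed X EX
  [set g | psi g = S1] (fun g => [set x | val g x = S1]) cX.
- by exists 1.
- apply: (@closed_rel_S3 _ (fun s t => s = S1) _ (val g)); exact: gc.
- apply: contrapT => /forallNP xNP.
  (* In S, 1 + s = 1 holds exactly for s different from 1. *)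
  have : 1 + g = 1.
    apply: val_inj; apply/funext => x; rewrite D0.
    by have := xNP x; rewrite /= ; case: (val g x).
  by move=> /(congr1 psi); rewrite psiD psi1 gP.
- exists (g * g'); first by rewrite /= psiM gP g'P.
  by move=> x; rewrite /setI /mkset M0; case: (val g x) (val g' x) => [] [].
have [|g gP|g gP|g g' gP g'P|v vP] := @compact_directed X (EX * EX)
  [set g | psi g.1 <> S0 /\ psi g.2 = S0]
  (fun g => [set x | val g.1 x <> S0 /\ val g.2 x = S0]) cX.
- by exists (1, 0); rewrite /= psi0 psi1.
- by apply: (@closed_rel_S3 _ (fun s t => s <> S0 /\ t = S0)); exact: gc.
- apply: contrapT => /forallNP xNP; case: gP => g1 g2.
  (* Meeting with the constant h = 1 + 1 leaves only the distinction between zero and nonzero. *)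
  have : (1 + 1) * g.1 * g.2 = (1 + 1) * g.1.
    apply: val_inj; apply/funext => x; rewrite !M0.
    have := xNP x; rewrite /= => nx.
    by case: (val g.1 x) (val g.2 x) nx => [] [] //= [].
  move=> /(congr1 psi); rewrite !psiM psiD psi1 g2.
  by case: (psi g.1) g1.
- case: gP g'P => g1 g2 [g1' g2'].
  exists (g.1 * g'.1, g.2 + g'.2).
    rewrite /= psiM psiD g2 g2'.
    by case: (psi g.1) (psi g'.1) g1 g1' => [] [].
  move=> x; rewrite /setI /mkset M0 D0.
  by case: (val g.1 x) (val g'.1 x) (val g.2 x) (val g'.2 x)
    => [] [] [] [] //= [].
have uv (g : EX) : lambda1 (val g u) (val g v) = Some (psi g).
  have u1 : psi g = S1 -> val g u = S1 by exact: uP.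
  have uN1 : psi g <> S1 -> val g u <> S1.
    (* [1 + g] takes the value 1 exactly where [g] does not, so it tests the negation. *)
    move=> gN1; have /uP : psi (1 + g) = S1.
      by rewrite psiD psi1; case: (psi g) gN1.
    by rewrite /mkset D0; case: (val g u).
  have v0 : psi g = S0 -> val g v = S0.
    (* Padding the pair with 1, or below with 0, isolates a single condition. *)
    by move=> g0; have [|_] := vP (1, g); first by rewrite /= psi1.
  have vN0 : psi g <> S0 -> val g v <> S0.
    by move=> gN0; have [|//] := vP (g, 0); first by rewrite /= psi0.
  case: (psi g) u1 uN1 v0 vN0.
  - by move=> _ uN1 -> // _; case: (val g u) uN1 => // /(_ _)[].
  - move=> _ uN1 _ vN0.
    have [nh1 nh0] : Sh <> S1 /\ Sh <> S0 by [].
    by case: (val g u) (val g v) (uN1 nh1) (vN0 nh0) => [] [].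
  - by move=> -> // _ _; case: (val g v) => // /(_ _)[].
have psi_hom : is_hom psi by [].
pose psi' : D S_os EX :=
  Sub (psi : power (ego S_os) EX) (mem_set psi_hom).
have [g /=|w _ wpsi] := eop tt (pair2 u v) psi'; first exact: uv.
by exists w => g; rewrite -[RHS](congr1 (fun p : D S_os EX => val p g) wpsi).
Qed.

End Evaluations.

(** * Duality, fullness and injectivity *)

Lemma S_os_duality : duality S_os.
Proof.
move=> A AS; apply: eval_alg_iso => // f fm.
apply: (interpolate (phi := val : D S_os A -> power (ego S_os) A)) fm.
- exact: compact_D.
- by move=> x; exact: set_valP x.
- by move=> a; have [] := E_morphism (eval_alg S_os a).
- exact: embedding_val.
Qed.

Lemma S_os_full_duality : full_duality S_os.
Proof.
split=> [|X [I [C [_ Ccl [f fiso]]]]]; first exact: S_os_duality.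
apply: (eval_str_iso fiso) => u uhom; apply: S_os_hom_eval uhom.
  exact: compact_IScP fiso Ccl.
exact: eval_str_embedding fiso.
Qed.

(** Interpolating over [C] by elements of [E X] gives an element that is itself a morphism on all of
    [X]. *)
Lemma S_os_injective : injective_ego S_os.
Proof.
move=> X [I [C' [_ C'cl [h hiso]]]] C Ccl f fm.
pose phi : sub C -> power (ego S_os) (E (M := S_os) X) :=
  val \o @eval_str S_os X \o val.
have [||||e eE] := interpolate (phi := phi) _ _ _ _ fm.
- by apply: compact_set_type => //; exact: compact_IScP hiso C'cl.
- by move=> x; exact: set_valP (eval_str (val x)).
- move=> g x; apply: (@continuous_comp (sub C) X (ego S_os) val (val g)).
    exact: continuous_val.
  by have [+ _ _] := E_morphism g; apply.
- apply: embedding_comp (embedding_val C) _.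
  exact: embedding_comp (eval_str_embedding hiso) (embedding_val _).
by exists (val e); [exact: E_morphism|exact: eE].
Qed.

(** * Optimality *)

Lemma morphism_comp (L : signature) (X Y Z : structure L) (f : X -> Y)
    (g : Y -> Z) :
  morphism f -> morphism g -> morphism (g \o f).
Proof.
move=> [fc frel fop] [gc grel gop]; split.
- by move=> x; apply: continuous_comp; [exact: fc|exact: gc].
- by move=> r v /frel/grel.
- by move=> o v w /fop/gop.
Qed.

Lemma continuous_S3 (T : topologicalType) (f : S3 -> T) : continuous f.
Proof.
move=> s U /nbhs_singleton Us.
by apply: (@filterS _ (nbhs s) _ [set s]) (discrete_set1 s) => _ ->.
Qed.

(* The algebra E(S) of endomorphisms of M has all points of S as homomorphisms,
   so an endomorphism f of M' acts on its dual over M' by f o ev_id. *)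
Lemma duality_endomorphism (M M' : alter_ego) (f : S3 -> S3) :
  duality M' -> morphism (f : ego M' -> ego M') ->
  morphism (f : ego M -> ego M).
Proof.
move=> dual fm; pose A := E (ego M).
have [idA idE] : exists a : A, val a = id.
  by apply: (@E_of_morphism M (ego M)); split=> //; exact: continuous_S3.
have AS : in_ISP A by exists S3, val; split=> //; exact: val_inj.
have [_ [g _ gK]] := dual A AS.
have alpham : morphism (f \o val (eval_alg M' idA) : D M' A -> ego M').
  by apply: morphism_comp fm; exact: E_morphism.
have [alpha alphaE] := E_of_morphism alpham.
(* Evaluation at the point of the dual induced by [s] recovers the value [f s]. *)
have -> : f = val (g alpha); last exact: E_morphism.
apply/funext => s.
pose s' : D M' A :=
  Sub (eval_str_fun (s : ego M) : power (ego M') A)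
    (mem_set (eval_str_hom (s : ego M))).
have := congr1 (fun b : E (D M' A) => val b s') (gK alpha).
by rewrite alphaE /= /eval_alg_fun /= /eval_str_fun idE => ->.
Qed.

Theorem theorem6 :
  strong_duality S_os /\
  ~ strong_duality (delete_rel (M := S_os) tt) /\
  ~ strong_duality (delete_op (M := S_os) tt).
Proof.
split; first by split; [exact: S_os_full_duality|exact: S_os_injective].
split=> -[[dual _] _].
(* The pair [(S0, Sh)] of [r2] is sent to [(Sh, S0)], outside [r2]. *)
- pose f s := if s == S0 then Sh else S0.
  have [|_ /(_ tt (pair2 S0 Sh)) frel _] := @duality_endomorphism S_os _ f dual.
  - split; [exact: continuous_S3|by move=> [[]]|].
    move=> [] v w /=; rewrite /lambda1_graph /=.
    by case: (v ord0) (v ord_max) w => [] [] [].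
  - by have [] := frel _.
(* Here [lambda1 S0 Sh] is [Sh], sent to [S1], but [lambda1 S0 S1] is [Sh]. *)
- pose f s := if s == S0 then S0 else S1.
  have [|_ _ /(_ tt (pair2 S0 Sh) Sh) fop] :=
    @duality_endomorphism S_os _ f dual.
  - split; [exact: continuous_S3| |by move=> [[]]].
    move=> r v; rewrite /= /r2 /=.
    by case: (v ord0) (v ord_max) => [] [] [] // _ _; split.
  - by have := fop erefl.
Qed.
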